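(* Let $\Sigma$, $\rho$, $E(x,y)$, $\mathbb Q$ and $\mathbb{IQ}$ be as in the context. Then: (i) every $\mathbb Q$-homomorphism $h\colon A\to B$ is order-preserving; (ii) the assignment $\mathcal I\colon\mathbb Q\to\mathbb{IQ}$ sending each object $A$ to $\mathcal I(A)$ and each homomorphism $h\colon A\to B$ to $\mathcal I(h)\colon\mathcal I(A)\to\mathcal I(B)$, $\mathcal I(h)([a,b])=[h(a),h(b)]$, is a well-defined functor.
   Context: $\Sigma$ is a set of constant and function symbols containing constants $0,1$. A polarity $\rho$ assigns to each $n$-ary function symbol $f\in\Sigma$ a tuple $\rho(f)\in\{+,-\}^n$. A $\rho$-partially ordered $\Sigma$-algebra ($\rho$-poalgebra) is a pair $(A,\leq)$ with $A$ a $\Sigma$-algebra and $\leq$ a partial order on $A$ such that each $f^A$ is monotone in its $k$-th argument if $\rho(f)_k=+$ and antitone in it if $\rho(f)_k=-$; it is bounded if $0^A\leq a\leq 1^A$ for all $a$. For a bounded $\rho$-poalgebra $A$, $\mathcal I(A)$ is the $(\Sigma\cup\{\Delta,\nabla,\iota\})$-algebra on the set $I(A)=\{[a,b]\mid a,b\in A, a\leq b\}$ of intervals, with $f^{\mathcal I(A)}([a_1,b_1],\dots,[a_n,b_n])=[f^A(c_1,\dots,c_n),f^A(d_1,\dots,d_n)]$, where $c_k=a_k,d_k=b_k$ if $\rho(f)_k=+$ and $c_k=b_k,d_k=a_k$ if $\rho(f)_k=-$ (so constants $c$ give $[c^A,c^A]$), $\Delta[a,b]=[a,a]$, $\nabla[a,b]=[b,b]$,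 $\iota=[0^A,1^A]$. A set $E(x,y)$ of $\Sigma$-equations determines the order of $A$ if for all $a,b\in A$: $a\leq b$ iff $t^A(a,b)=s^A(a,b)$ for every $t=s$ in $E(x,y)$. Standing assumptions: $\mathbb Q$ is a $\Sigma$-quasivariety of bounded $\rho$-poalgebras and $E(x,y)$ is a set of $\Sigma$-equations determining the order of every $A\in\mathbb Q$. $\mathbb{IQ}$ is the quasivariety generated by $\{\mathcal I(A)\mid A\in\mathbb Q\}$. $\mathbb Q$ and $\mathbb{IQ}$ are regarded as categories with homomorphisms as morphisms. *)

(* Defs.v *)
From Stdlib Require List.
From Stdlib Require Import FunctionalExtensionality ProofIrrelevance.
From mathcomp Require Import all_boot.

Set Implicit Arguments.
Unset Strict Implicit.
Unset Printing Implicit Defensive.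

Record signature := Signature {
  csym : Type;
  fsym : Type;
  arity : fsym -> nat;
  zero : csym;
  one : csym;
  zero_neq_one : zero <> one
}.

Arguments arity {s} _.
Arguments zero {s}.
Arguments one {s}.

Record algebra (S : signature) := Algebra {
  carrier :> Type;
  cst : csym S -> carrier;
  fn : forall f : fsym S, ('I_(arity f) -> carrier) -> carrier
}.

Arguments cst {S} a _.
Arguments fn {S} a _ _.

Record hom (S : signature) (A B : algebra S) := Hom {
  hom_fun :> A -> B;
  hom_cst : forall c, hom_fun (cst A c) = cst B c;
  hom_fn : forall f args, hom_fun (fn A f args) = fn B f (fun k => hom_fun (args k))
}.

Lemma hom_ext (S : signature) (A B : algebra S) (g h : hom A B) :
  (forall x, g x = h x) -> g = h.
Proof.
case: g h => [g gc gf] [h hc hf] /= /functional_extensionality gh.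
subst h; congr Hom; exact: proof_irrelevance.
Qed.

Definition hom_id (S : signature) (A : algebra S) : hom A A :=
  @Hom S A A (fun x => x) (fun _ => erefl) (fun _ _ => erefl).

Lemma comp_cst (S : signature) (A B C : algebra S) (g : hom B C) (h : hom A B) c :
  g (h (cst A c)) = cst C c.
Proof. by rewrite !hom_cst. Qed.

Lemma comp_fn (S : signature) (A B C : algebra S) (g : hom B C) (h : hom A B)
    f args :
  g (h (fn A f args)) = fn C f (fun k => g (h (args k))).
Proof. by rewrite !hom_fn. Qed.

Definition hom_comp (S : signature) (A B C : algebra S)
    (g : hom B C) (h : hom A B) : hom A C :=
  @Hom S A C (fun x => g (h x)) (comp_cst g h) (@comp_fn S A B C g h).

Inductive term (S : signature) (X : Type) : Type :=
| Var of X
| Cst of csym S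
| App (f : fsym S) of ('I_(arity f) -> term S X).

Fixpoint eval (S : signature) (X : Type) (A : algebra S) (v : X -> A)
    (t : term S X) : A :=
  match t with
  | Var x => v x
  | Cst c => cst A c
  | App f ts => fn A f (fun k => eval v (ts k))
  end.

Definition equation (S : signature) (X : Type) : Type :=
  (term S X * term S X)%type.

Definition holds (S : signature) (X : Type) (A : algebra S) (v : X -> A)
    (e : equation S X) : Prop :=
  eval v e.1 = eval v e.2.

Record quasiequation (S : signature) := Quasiequation {
  premises : seq (equation S nat);
  conclusion : equation S nat
}.

Definition satisfies (S : signature) (A : algebra S) (q : quasiequation S) : Prop :=
  forall v : nat -> A,
    List.Forall (holds v) (premises q) -> holds v (conclusion q).

Definition quasivariety (S : signature) (V : algebra S -> Prop) : Prop :=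
  exists Phi : quasiequation S -> Prop,
    forall A : algebra S, V A <-> (forall q, Phi q -> satisfies A q).

Definition generated_quasivariety (S : signature) (K : algebra S -> Prop)
    (A : algebra S) : Prop :=
  forall V : algebra S -> Prop,
    quasivariety V -> (forall C, K C -> V C) -> V A.

Inductive sign := Plus | Minus.

Definition polarity (S : signature) : Type :=
  forall f : fsym S, 'I_(arity f) -> sign.

Definition update (n : nat) (T : Type) (args : 'I_n -> T) (k : 'I_n) (x : T) :
    'I_n -> T :=
  fun i => if i == k then x else args i.

Definition compatible (S : signature) (rho : polarity S) (A : algebra S)
    (le : A -> A -> Prop) : Prop :=
  forall (f : fsym S) (k : 'I_(arity f)) (args : 'I_(arity f) -> A) (x y : A),
    le x y ->
    match rho f k with
    | Plus => le (fn A f (update args k x)) (fn A f (update args k y))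
    | Minus => le (fn A f (update args k y)) (fn A f (update args k x))
    end.

Record poalgebra (S : signature) (rho : polarity S) := Poalgebra {
  po_alg :> algebra S;
  ple : po_alg -> po_alg -> Prop;
  ple_refl : forall x, ple x x;
  ple_trans : forall x y z, ple x y -> ple y z -> ple x z;
  ple_anti : forall x y, ple x y -> ple y x -> x = y;
  ple_compatible : compatible rho ple
}.

Arguments ple {S rho} _ _ _.

Record bpoalgebra (S : signature) (rho : polarity S) := Bpoalgebra {
  bpo_poalg :> poalgebra rho;
  bpo_ge0 : forall a, ple bpo_poalg (cst bpo_poalg zero) a;
  bpo_le1 : forall a, ple bpo_poalg a (cst bpo_poalg one)
}.

(** [Q] is a class of pairs (algebra, order); its algebra reducts form a
    quasivariety. The order is not part of the signature. *)
Definition quasivariety_of_bpoalgebras (S : signature) (rho : polarity S)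
    (Q : bpoalgebra rho -> Prop) : Prop :=
  quasivariety (fun A : algebra S =>
    exists P : bpoalgebra rho, Q P /\ po_alg P = A).

Inductive xy := x_var | y_var.

Definition val_xy (T : Type) (a b : T) (z : xy) : T :=
  match z with x_var => a | y_var => b end.

Definition determines_order (S : signature) (rho : polarity S)
    (E : equation S xy -> Prop) (A : poalgebra rho) : Prop :=
  forall a b : A, ple A a b <-> (forall e, E e -> holds (val_xy a b) e).

Definition order_preserving (S : signature) (rho : polarity S)
    (A B : poalgebra rho) (h : A -> B) : Prop :=
  forall a b : A, ple A a b -> ple B (h a) (h b).

Inductive ifsym (F : Type) := Base of F | Delta | Nabla.
Arguments Delta {F}.
Arguments Nabla {F}.

Definition iarity (S : signature) (f : ifsym (fsym S)) : nat :=
  match f with Base g => arity g | Delta => 1 | Nabla => 1 end.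

Lemma isig_neq (S : signature) : Some (@zero S) <> Some one.
Proof. by case=> /zero_neq_one. Qed.

(** The constant [iota] is [None : option (csym S)]. *)
Definition isig (S : signature) : signature :=
  @Signature (option (csym S)) (ifsym (fsym S)) (@iarity S)
    (Some zero) (Some one) (@isig_neq S).

(** The interval [a,b] is nonempty, hence is determined by its endpoints and
    encoded as the pair of them. *)
Record interval (S : signature) (rho : polarity S) (A : poalgebra rho) :=
  Interval { lo : A; hi : A; lo_le_hi : ple A lo hi }.

Definition lower_args (S : signature) (rho : polarity S) (A : poalgebra rho)
    (f : fsym S) (u : 'I_(arity f) -> interval A) : 'I_(arity f) -> A :=
  fun k => match rho f k with Plus => lo (u k) | Minus => hi (u k) end.

Definition upper_args (S : signature) (rho : polarity S) (A : poalgebra rho)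
    (f : fsym S) (u : 'I_(arity f) -> interval A) : 'I_(arity f) -> A :=
  fun k => match rho f k with Plus => hi (u k) | Minus => lo (u k) end.

Lemma fn_lower_upper (S : signature) (rho : polarity S) (A : poalgebra rho)
    (f : fsym S) (u : 'I_(arity f) -> interval A) :
  ple A (fn A f (lower_args u)) (fn A f (upper_args u)).
Proof.
set c := lower_args u; set d := upper_args u.
pose mix j : 'I_(arity f) -> A := fun i => if i < j then d i else c i.
have step j : j <= arity f -> ple A (fn A f c) (fn A f (mix j)).
  elim: j => [_|j IH lt_j].
    have -> : mix 0 = c by apply: functional_extensionality.
    exact: ple_refl.
  apply: ple_trans (IH (ltnW lt_j)) _.
  pose k := Ordinal lt_j.
  have -> : mix j = update (mix j) k (c k).
    apply: functional_extensionality => i; rewrite /update.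
    by case: eqP => // ->; rewrite /mix /= ltnn.
  have -> : mix j.+1 = update (mix j) k (d k).
    apply: functional_extensionality => i; rewrite /update /mix ltnS leq_eqVlt.
    have -> : (val i == j) = (i == k) by [].
    by case: eqP => // ->.
  have := @ple_compatible _ _ A f k (mix j) (lo (u k)) (hi (u k)) (lo_le_hi (u k)).
  by rewrite /c /d /lower_args /upper_args; case: (rho f k).
have -> : d = mix (arity f).
  by apply: functional_extensionality => i; rewrite /mix ltn_ord.
exact: step.
Qed.

Definition point (S : signature) (rho : polarity S) (A : poalgebra rho) (a : A) :
    interval A :=
  Interval (ple_refl a).

Definition icst (S : signature) (rho : polarity S) (A : bpoalgebra rho)
    (c : csym (isig S)) : interval A :=
  match c with
  | Some c => point (cst A c)
  | None => Interval (bpo_ge0 (cst A one))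
  end.

Definition ifn (S : signature) (rho : polarity S) (A : bpoalgebra rho)
    (f : fsym (isig S)) : ('I_(arity f) -> interval A) -> interval A :=
  match f return ('I_(iarity f) -> interval A) -> interval A with
  | Base g => fun u => Interval (fn_lower_upper u)
  | Delta => fun u => point (lo (u ord0))
  | Nabla => fun u => point (hi (u ord0))
  end.

Definition interval_algebra (S : signature) (rho : polarity S)
    (A : bpoalgebra rho) : algebra (isig S) :=
  @Algebra (isig S) (interval A) (@icst S rho A) (@ifn S rho A).

Definition IQ (S : signature) (rho : polarity S) (Q : bpoalgebra rho -> Prop) :
    algebra (isig S) -> Prop :=
  generated_quasivariety (fun C => exists A, Q A /\ C = interval_algebra A).

Record category := Category {
  obj :> Type;
  mor : obj -> obj -> Type;
  idm : forall A, mor A A;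
  cmp : forall A B C, mor B C -> mor A B -> mor A C;
  cmp_idl : forall A B (h : mor A B), cmp (idm B) h = h;
  cmp_idr : forall A B (h : mor A B), cmp h (idm A) = h;
  cmp_assoc : forall A B C D (h : mor C D) (g : mor B C) (f : mor A B),
    cmp h (cmp g f) = cmp (cmp h g) f
}.

Arguments mor {c} _ _.
Arguments idm {c} _.
Arguments cmp {c A B C} _ _.

Definition is_functor (C D : category) (F0 : C -> D)
    (F1 : forall A B : C, mor A B -> mor (F0 A) (F0 B)) : Prop :=
  (forall A : C, F1 A A (idm A) = idm (F0 A)) /\
  (forall (A B X : C) (g : mor B X) (h : mor A B),
     F1 A X (cmp g h) = cmp (F1 B X g) (F1 A B h)).

(** Morphisms are all homomorphisms of the reducts [alg]; they are not required
    to respect any further structure of [T]. *)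
Definition class_category (S : signature) (T : Type) (alg : T -> algebra S)
    (V : T -> Prop) : category.
Proof.
refine (@Category {A : T | V A}
  (fun A B => hom (alg (sval A)) (alg (sval B)))
  (fun A => hom_id (alg (sval A)))
  (fun A B C g h => hom_comp g h) _ _ _).
- by move=> A B h; apply: hom_ext.
- by move=> A B h; apply: hom_ext.
- by move=> A B C D h g f; apply: hom_ext.
Defined.

Definition Qcat (S : signature) (rho : polarity S) (Q : bpoalgebra rho -> Prop) :
    category :=
  class_category (fun A : bpoalgebra rho => po_alg A) Q.

Definition IQcat (S : signature) (rho : polarity S) (Q : bpoalgebra rho -> Prop) :
    category :=
  class_category (fun C : algebra (isig S) => C) (IQ Q).

Definition I_obj (S : signature) (rho : polarity S) (Q : bpoalgebra rho -> Prop)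
    (HI : forall A, Q A -> IQ Q (interval_algebra A)) (A : Qcat Q) : IQcat Q :=
  exist (IQ Q) (interval_algebra (sval A)) (HI (sval A) (proj2_sig A)).

(* Main.v *)
(** Homomorphisms preserve the equations in [E(x,y)], hence the order they
    define. Endpointwise application of [h] is then a map of intervals, and it
    commutes with the operations because these are computed endpointwise. *)

Require Import Defs.
From Stdlib Require Import FunctionalExtensionality ProofIrrelevance.
From mathcomp Require Import all_boot.

Lemma hom_eval (S : signature) (X : Type) (A B : algebra S) (h : hom A B)
    (v : X -> A) (t : term S X) :
  h (eval v t) = eval (fun x => h (v x)) t.
Proof.
elim: t => [x|c|f ts IH] //=; first exact: hom_cst.
by rewrite hom_fn; congr (fn B f _); apply: functional_extensionality.
Qed.

Lemma hom_holds (S : signature) (X : Type) (A B : algebra S) (h : hom A B)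
    (v : X -> A) (e : equation S X) :
  holds v e -> holds (fun x => h (v x)) e.
Proof. by rewrite /holds -!hom_eval => ->. Qed.

(** One and the same [E] defines both orders: it is read off from the order in [A], transported
    along [h], and turned back into an inequality in [B]. *)
Lemma hom_order_preserving (S : signature) (rho : polarity S)
    (E : equation S xy -> Prop) (A B : poalgebra rho) (h : hom A B) :
  determines_order E A -> determines_order E B -> order_preserving h.
Proof.
move=> EA EB a b /EA ab; apply/EB => e /ab /(hom_holds _ _ _ _ h).
suff -> : (fun z => h (val_xy a b z)) = val_xy (h a) (h b) by [].
by apply: functional_extensionality => -[].
Qed.

Lemma interval_ext (S : signature) (rho : polarity S) (A : poalgebra rho)
    (u v : interval A) :
  lo u = lo v -> hi u = hi v -> u = v.
Proof.
case: u v => [a b ab] [c d cd] /= ac bd; subst c d.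
by congr Interval; apply: proof_irrelevance.
Qed.

Section IntervalMap.
Context {S : signature} {rho : polarity S} {A B : bpoalgebra rho}.
Context {h : hom A B} (h_mono : order_preserving h).

Definition interval_map (u : interval A) : interval B :=
  Interval (h_mono _ _ (lo_le_hi u)).

Lemma interval_map_cst c :
  interval_map (cst (interval_algebra A) c) = cst (interval_algebra B) c.
(* The endpoints of [iota] are the constants [zero] and [one], so [hom_cst] covers this case too. *)
Proof. by case: c => [c|]; apply: interval_ext; apply: hom_cst. Qed.

(** Which endpoint enters at position [k] depends only on the sign [rho g k], which is the same for
    [A] and [B]; hence selecting endpoints commutes with applying [h]. *)
Lemma interval_map_fn f args :
  interval_map (fn (interval_algebra A) f args)
  = fn (interval_algebra B) f (fun k => interval_map (args k)).
Proof.
(* [Delta] and [Nabla] hold by computation; the two endpoints for a symbol [g] of the base signature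
   remain. *)
case: f args => [g||] args; apply: interval_ext => //=; rewrite hom_fn;
  congr (fn B g _); apply: functional_extensionality => k;
  by rewrite /lower_args /upper_args; case: (rho g k).
Qed.

Definition interval_hom : hom (interval_algebra A) (interval_algebra B) :=
  @Hom _ (interval_algebra A) (interval_algebra B)
    interval_map interval_map_cst interval_map_fn.

End IntervalMap.

(** A generator lies in every quasivariety containing all generators. *)
Lemma interval_algebra_IQ (S : signature) (rho : polarity S)
    (Q : bpoalgebra rho -> Prop) (A : bpoalgebra rho) :
  Q A -> IQ Q (interval_algebra A).
Proof. by move=> QA V _; apply; exists A. Qed.

Theorem theorem8p6 (S : signature) (rho : polarity S)
    (E : equation S xy -> Prop) (Q : bpoalgebra rho -> Prop)
    (HQ : quasivariety_of_bpoalgebras Q)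
    (HE : forall A : bpoalgebra rho, Q A -> determines_order E A) :
  (forall (A B : bpoalgebra rho), Q A -> Q B ->
     forall h : hom A B, order_preserving h)
  /\
  (exists HI : forall A : bpoalgebra rho, Q A -> IQ Q (interval_algebra A),
   exists I_mor : forall A B : Qcat Q,
       hom (sval A) (sval B) ->
       hom (interval_algebra (sval A)) (interval_algebra (sval B)),
     (forall (A B : Qcat Q) (h : hom (sval A) (sval B))
             (a b : sval A) (ab : ple (sval A) a b),
        exists hab : ple (sval B) (h a) (h b),
          I_mor A B h (Interval ab) = Interval hab)
     /\ @is_functor (Qcat Q) (IQcat Q) (I_obj HI) I_mor).
Proof.
have mono (A B : bpoalgebra rho) :
    Q A -> Q B -> forall h : hom A B, order_preserving h.
  by move=> QA QB h; apply: hom_order_preserving (HE A QA) (HE B QB).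
split=> //; exists (@interval_algebra_IQ S rho Q).
exists (fun A B h => interval_hom (mono _ _ (proj2_sig A) (proj2_sig B) h)).
split=> [A B h a b ab|]; first by eexists.
(* Both sides have the same endpoints by computation; they may differ only in the proofs that these
   are ordered, which [interval_ext] disregards. *)
by split=> [A|A B X g h]; apply: hom_ext => u; apply: interval_ext.
Qed.
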